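(* Let $p\neq 2$ be a prime, $d\ge 3$, and let $H$ be a $d$-generator special $p$-group of rank $\frac12 d(d-1)$. Then $H$ is non-capable if and only if $H^p\cong\mathbb{Z}_p$.
   Context: A special $p$-group is a finite non-abelian $p$-group $H$ with $H'=Z(H)=\Phi(H)$ elementary abelian; it has rank $k$ if $|H'|=p^k$. ''$d$-generator'' means that the minimal number of generators is $d$. $H^p$ is the subgroup generated by all $p$-th powers of elements of $H$. A group $H$ is capable if $H\cong E/Z(E)$ for some group $E$. *)

(* Defs.v *)
From HB Require Import structures.
From mathcomp Require Import all_boot all_fingroup all_algebra all_solvable.
From mathcomp Require Import generic_quotient boolp.

Set Implicit Arguments.
Unset Strict Implicit.
Unset Printing Implicit Defensive.

Local Open Scope group_scope.
Local Open Scope quotient_scope.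

(* In the definition of capability the covering group may be infinite, hence
   it is a groupType; the quotients of fingroup only cover finite groups, so the
   quotient of a groupType by its center is built here. The choiceType structure
   included in groupType is no restriction under the axioms of boolp
   (gen_eqMixin, gen_choiceMixin). *)
Section CenterQuotient.
Variable E : groupType.
Implicit Types x y z : E.

Definition in_center z : bool := `[< forall x, commute z x >].

Lemma in_centerP z : reflect (forall x, z * x = x * z) (in_center z).
Proof. exact: asboolP. Qed.

Lemma in_center1 : in_center 1.
Proof. by apply/in_centerP => x; rewrite mul1g mulg1. Qed.

Lemma in_centerM y z : in_center y -> in_center z -> in_center (y * z).
Proof.
move=> /in_centerP cy /in_centerP cz; apply/in_centerP => x.
by rewrite -mulgA (cz x) mulgA (cy x) mulgA.
Qed.

Lemma in_centerV z : in_center z -> in_center z^-1.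
Proof.
move=> /in_centerP cz; apply/in_centerP => x.
by apply: (mulgI z); rewrite mulgA mulgV mul1g mulgA cz -mulgA mulgV mulg1.
Qed.

Definition center_coset_eq x y : bool := in_center (x^-1 * y).

Lemma center_coset_eq_refl : reflexive center_coset_eq.
Proof. by move=> x; rewrite /center_coset_eq mulVg in_center1. Qed.

Lemma center_coset_eq_sym : symmetric center_coset_eq.
Proof.
move=> x y; rewrite /center_coset_eq.
by apply/idP/idP => /in_centerV; rewrite invgM invgK.
Qed.

Lemma center_coset_eq_trans : transitive center_coset_eq.
Proof.
move=> y x z cxy cyz; rewrite /center_coset_eq.
suff -> : x^-1 * z = (x^-1 * y) * (y^-1 * z) by exact: in_centerM.
by rewrite mulgA mulgK.
Qed.

Canonical center_coset_equiv :=
  EquivRel center_coset_eq center_coset_eq_refl center_coset_eq_sym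
    center_coset_eq_trans.

(* E / Z(E) *)
Definition center_quotient := {eq_quot center_coset_eq}.

HB.instance Definition _ := Choice.on center_quotient.
HB.instance Definition _ := EqQuotient.on center_quotient.

Lemma center_quotient_eqP x y :
  reflect (x = y %[mod center_quotient]) (in_center (x^-1 * y)).
Proof.
by rewrite -[in_center _]/(center_coset_eq x y) -eqmodE; exact: eqP.
Qed.

Definition cq_one : center_quotient := \pi_center_quotient 1.
Definition cq_mul (a b : center_quotient) : center_quotient :=
  \pi_center_quotient (repr a * repr b).
Definition cq_inv (a : center_quotient) : center_quotient :=
  \pi_center_quotient (repr a)^-1.

Lemma cq_mulE x y :
  cq_mul (\pi_center_quotient x) (\pi_center_quotient y)
  = \pi_center_quotient (x * y).
Proof.
rewrite /cq_mul; case: piP => x' /center_quotient_eqP cx.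
case: piP => y' /center_quotient_eqP cy.
apply/esym/center_quotient_eqP.
suff -> : (x * y)^-1 * (x' * y') = (x^-1 * x') * (y^-1 * y').
  exact: in_centerM.
move/in_centerP: cx => cx.
by rewrite [RHS]mulgA cx invgM !mulgA.
Qed.

Lemma cq_invE x :
  cq_inv (\pi_center_quotient x) = \pi_center_quotient x^-1.
Proof.
rewrite /cq_inv; case: piP => x' /center_quotient_eqP cx.
apply/center_quotient_eqP; rewrite invgK.
suff -> : x' * x^-1 = x^-1 * x' by exact: cx.
by move/in_centerP: cx => /(_ x^-1); rewrite -mulgA => /mulgI.
Qed.

Lemma cq_mulA : associative cq_mul.
Proof.
move=> a b c; rewrite -[a]reprK -[b]reprK -[c]reprK.
rewrite (cq_mulE (repr a) (repr b)) (cq_mulE (repr b) (repr c)).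
by rewrite !cq_mulE mulgA.
Qed.

Lemma cq_mul1g : left_id cq_one cq_mul.
Proof. by move=> a; rewrite -[a]reprK cq_mulE mul1g. Qed.

Lemma cq_mulg1 : right_id cq_one cq_mul.
Proof. by move=> a; rewrite -[a]reprK cq_mulE mulg1. Qed.

Lemma cq_mulVg : left_inverse cq_one cq_inv cq_mul.
Proof. by move=> a; rewrite -[a]reprK cq_invE cq_mulE mulVg. Qed.

Lemma cq_mulgV : right_inverse cq_one cq_inv cq_mul.
Proof. by move=> a; rewrite -[a]reprK cq_invE cq_mulE mulgV. Qed.

HB.instance Definition _ :=
  isGroup.Build center_quotient cq_mulA cq_mul1g cq_mulg1 cq_mulVg cq_mulgV.

End CenterQuotient.

Definition isomorphic (G K : groupType) : Prop :=
  exists2 f : G -> K, {morph f : x y / x * y >-> x * y} & bijective f.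

Definition capable (G : groupType) : Prop :=
  exists E : groupType, isomorphic G (center_quotient E).

Section SpecialGroups.
Variables (gT : finGroupType) (p : nat) (H : {group gT}).

(* The library's special G, i.e. 'Phi(G) = 'Z(G) /\ G^`(1) = 'Z(G), also holds
   for the trivial group, hence the explicit nonabelianness. *)
Definition special_pgroup : Prop :=
  [/\ p.-group H, ~~ abelian H, special H & p.-abelem H^`(1)].

(* H^p; kept literal, since 'Mho^1(H) takes no prime as argument *)
Definition power_subgroup : {group gT} := <<[set x ^+ p | x in H]>>%G.

End SpecialGroups.

(* Main.v *)
Require Import Defs.
From HB Require Import structures.
From mathcomp Require Import all_boot all_fingroup all_algebra all_solvable.
From mathcomp Require Import generic_quotient boolp ssrAC mxabelem zify ring.

(* Put V = H/H', a vector space of dimension d over F_p. By the rank hypothesis the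
   commutator map identifies H' with the exterior square of V, and x |-> x^p
   induces a linear map f : V -> H'.

   If H^p has order p, every cover E of H (that is, E/Z(E) = H) has the lifts of H^p
   in its center, so H is not capable.

   For the converse we construct a cover E of class 3 in which [H', E] is the
   quotient of the degree 3 part of the free Lie algebra on V by the elements
   [f x, x]. It lives in the truncated tensor algebra of V, with coordinates in
   Z/p^2 in degree 1 and in F_p in degree 2, twisted by a bilinear cocycle that
   accounts for p-th powers of commutators. If its center is too big, there is
   w <> 0 in H' with [w, v] in the span of the [f x, y] + [f y, x] for all v.
   Evaluating these tensors at linear forms a, b, a gives, on the dual space V*,
   the bracket [a, b] = f^*(a /\ b) and a commutative product o such that
   a o [a, b] = w(a, b) a. A dimension count shows that such a bracket has rank
   one when w <> 0, i.e. f has rank one and |H^p| = p. *)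

Set Implicit Arguments.
Unset Strict Implicit.
Unset Printing Implicit Defensive.

Import GRing.Theory.
Local Open Scope group_scope.

(** * Covers of special p-groups *)

Section Capable.
Local Open Scope quotient_scope.

(** A surjective morphism whose kernel is exactly the center is easier to build and to use than an
    isomorphism with the quotient type. *)
Lemma capableP (G : groupType) :
  capable G <-> exists (E : groupType) (s : E -> G),
    [/\ {morph s : x y / x * y}, forall g, exists e, s e = g
      & forall e, s e = 1 <-> in_center e].
Proof.
split=> [[E [f fM [g fK gK]]]|[E [s [sM s_surj s_ker]]]].
  have piE : forall u : center_quotient E, exists e, \pi_(center_quotient E) e = u.
    by move=> u; exists (repr u); rewrite reprK.
  have gM : {morph g : x y / x * y}.
    by move=> u v; apply: (can_inj fK); rewrite fM !gK.
  exists E, (fun e => g (\pi_(center_quotient E) e)); split.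
  - by move=> x y; rewrite -gM -[X in _ = g X]/(cq_mul _ _) cq_mulE.
  - by move=> h; have [e eE] := piE (f h); exists e; rewrite eE fK.
  - move=> e; have g1 : g 1 = 1 by apply: (mulgI (g 1)); rewrite -gM !mulg1.
    split=> [ge|ce].
      have /center_quotient_eqP : \pi_(center_quotient E) 1 = \pi_(center_quotient E) e.
        by apply: (can_inj gK); rewrite ge -[\pi_(center_quotient E) 1]/(1 : center_quotient E) g1.
      by rewrite invg1 mul1g.
    have /center_quotient_eqP <- : in_center (1^-1 * e) by rewrite invg1 mul1g.
    exact: g1.
have sV e : s e^-1 = (s e)^-1.
  have s1 : s 1 = 1 by apply: (mulgI (s 1)); rewrite -sM !mulg1.
  by apply: (mulgI (s e)); rewrite -sM !mulgV.
have sP x y : s x = s y <-> in_center (x^-1 * y).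
  rewrite -s_ker sM sV; split=> [->|sxy]; first by rewrite mulVg.
  by apply/esym/(mulgI (s x)^-1); rewrite sxy mulVg.
exists E; pose r h := sval (cid (s_surj h)).
have rK h : s (r h) = h by rewrite /r; case: cid.
exists (fun h => \pi_(center_quotient E) (r h)).
  move=> x y; rewrite -[RHS]/(cq_mul _ _) cq_mulE.
  by apply/center_quotient_eqP/sP; rewrite sM !rK.
exists (fun u : center_quotient E => s (repr u)) => [h|u].
  rewrite -[RHS]rK; apply/sP/center_quotient_eqP.
  by rewrite reprK.
by rewrite -[RHS]reprK; apply/center_quotient_eqP/sP; rewrite rK.
Qed.

End Capable.

Section Special.
Variables (p : nat) (gT : finGroupType) (H : {group gT}).
Hypotheses (p_pr : prime p) (p_neq2 : p != 2) (spH : special_pgroup p H).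

Lemma der_center : H^`(1) = 'Z(H).
Proof. by case: spH => _ _ []. Qed.

Lemma comm_der x y : x \in H -> y \in H -> [~ x, y] \in H^`(1).
Proof. by move=> Hx Hy; rewrite derg1 mem_commg. Qed.

Lemma der_commute x z : x \in H -> z \in H^`(1) -> commute x z.
Proof.
by move=> Hx; rewrite der_center => /setIP[_ /centP cz]; apply/commute_sym/cz.
Qed.

Lemma der_exp z : z \in H^`(1) -> z ^+ p = 1.
Proof. by case: spH => _ _ _ /abelemP-[] // _; apply. Qed.

(** In class 2 the error term is [[y, x]] to the power ['C(p, 2)], which [p] divides because it is
    odd, and [H'] has exponent [p]. *)
Lemma expMp x y : x \in H -> y \in H -> (x * y) ^+ p = x ^+ p * y ^+ p.
Proof.
move=> Hx Hy; have yx := comm_der Hy Hx.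
rewrite expMg_Rmul; [|exact: der_commute|exact: der_commute].
have p_odd : p %| 'C(p, 2).
  by apply: prime_dvd_bin => //; rewrite [2 < p]ltn_neqAle [2 == p]eq_sym p_neq2 prime_gt1.
by case/dvdnP: p_odd => k ->; rewrite mulnC expgM (der_exp yx) expg1n mulg1.
Qed.

Lemma power_mem x : x \in H -> x ^+ p \in power_subgroup p H.
Proof. by move=> Hx; apply: mem_gen; apply: imset_f. Qed.

(* If s is the projection of a cover E of H and u generates H^p, then any e in E
   with (s e)^p <> 1 commutes with the lifts of u, since these are central
   multiples of powers of e; as such e generate E, the lifts of u are central. *)
Lemma card_power_not_capable : #|power_subgroup p H| = p -> ~ capable (subg_of H).
Proof.
move=> cardP /capableP[E [s [sM s_surj s_ker]]].
have [x Hx xp] : exists2 x, x \in H & x ^+ p != 1.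
  apply/exists_inP; apply: contraT => /exists_inPn xp1.
  have : #|power_subgroup p H| <= 1.
    rewrite -trivg_card_le1 -subG1 gen_subG; apply/subsetP=> _ /imsetP[y Hy ->].
    by rewrite inE; have := xp1 y Hy; rewrite negbK.
  by rewrite cardP leqNgt prime_gt1.
have s1 : s 1 = 1 by apply: (mulgI (s 1)); rewrite -sM !mulg1.
have sX e n : s (e ^+ n) = s e ^+ n.
  by elim: n => [|n IHn]; rewrite ?expg0 // !expgS sM IHn.
have sV e : s e^-1 = (s e)^-1 by apply: (mulgI (s e)); rewrite -sM !mulgV.
pose S e := sgval (s e).
have SM e e' : S (e * e') = S e * S e' by rewrite /S sM.
have SX e n : S (e ^+ n) = S e ^+ n.
  by rewrite /S sX; elim: n => [|n IHn] //; rewrite !expgS -IHn.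
have SH e : S e \in H by exact: subgP.
have [xt xtE] := s_surj (subg H x).
have Sx : S xt = x by rewrite /S xtE subgK.
have com e : S e ^+ p != 1 -> commute (xt ^+ p) e.
  move=> ep.
  have /cycleP[k kE] : x ^+ p \in <[S e ^+ p]>.
    suff -> : <[S e ^+ p]> = power_subgroup p H by rewrite power_mem.
    apply/eqP; rewrite eqEcard cycle_subG power_mem //= cardP.
    have dv : #[S e ^+ p] %| p.
      by rewrite -[p in X in _ %| X]cardP cardSg // cycle_subG power_mem.
    have /primeP[_ /(_ _ dv)] := p_pr.
    by rewrite order_eq1 (negPf ep) => /eqP; rewrite -orderE => ->.
  have /s_ker/in_centerP cz : s ((e ^+ (p * k))^-1 * xt ^+ p) = 1.
    rewrite sM sV; apply: (mulgI (s (e ^+ (p * k)))); rewrite mulKVg mulg1.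
    by apply: subg_inj; rewrite -!/(S _) !SX expgM -kE Sx.
  have -> : xt ^+ p = e ^+ (p * k) * ((e ^+ (p * k))^-1 * xt ^+ p) by rewrite mulKVg.
  apply/commute_sym/commuteM; first by apply: commuteX.
  exact/commute_sym/cz.
have /s_ker sx1 : in_center (xt ^+ p).
  (* If [(S e)^p = 1], then [e * xt] has image with [p]-th power [x^p <> 1], so [com] applies to
     [xt] and to [e * xt], hence to their quotient. *)
  apply/in_centerP=> e; have [ep|ep] := eqVneq (S e ^+ p) 1; last exact: com.
  have cx : commute (xt ^+ p) xt by apply: com; rewrite Sx.
  have cex : commute (xt ^+ p) (e * xt).
    by apply: com; rewrite SM expMp // ep mul1g Sx.
  rewrite -[e](mulgK xt); apply: commuteM => //; exact: commuteV.
by move/eqP: xp; apply; rewrite -Sx -SX /S sx1.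
Qed.
End Special.

Local Open Scope ring_scope.

(** * Brackets with a compatible commutative product *)

Section LinearFunctional.
Variables (K : fieldType) (V : vectType K).
Variables (br ci : V -> 'End(V)) (th : {scalar V}).
Hypotheses (brxx : forall x, br x x = 0) (brC : forall x y, br x y = - br y x).
Hypothesis ciC : forall x y, ci x y = ci y x.
Hypothesis ci_br : forall a b, ci a (br a b) = th (br a b) *: a.

(* T is trilinear and, by ci_br, alternating. *)
Let T z c b := ci z (br c b) - th (br c b) *: z.

Let brDl x y z : br (x + y) z = br x z + br y z.
Proof. by rewrite brC linearD opprD -brC -brC. Qed.

Let ciDl x y z : ci (x + y) z = ci x z + ci y z.
Proof. by rewrite ciC linearD /= !(ciC z). Qed.

Let brZl k x z : br (k *: x) z = k *: br x z.
Proof. by rewrite brC linearZ -scalerN -brC. Qed.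

Let TC23 z c b : T z c b = - T z b c.
Proof. by rewrite /T (brC c) !linearN /= scaleNr opprK opprB addrC. Qed.

Let Txx z b : T z z b = 0.
Proof. by rewrite /T ci_br subrr. Qed.

Let TDl x y c b : T (x + y) c b = T x c b + T y c b.
Proof. by rewrite /T ciDl scalerDr opprD addrACA. Qed.

Let TDm x c d b : T x (c + d) b = T x c b + T x d b.
Proof. by rewrite /T brDl !linearD /= scalerDl opprD addrACA. Qed.

Let TC12 z c b : T z c b = - T c z b.
Proof.
apply/eqP; rewrite -addr_eq0; apply/eqP.
by rewrite -(Txx (z + c) b) TDl !TDm !Txx add0r addr0.
Qed.

Let Trot z c b : T z c b = T c b z.
Proof. by rewrite TC12 TC23 opprK. Qed.

Let T0 z c b : br c b = 0 -> T z c b = 0.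
Proof. by rewrite /T => ->; rewrite !linear0 scale0r subrr. Qed.

Let ciE z c b : ci z (br c b) = th (br c b) *: z + T z c b.
Proof. by rewrite addrC subrK. Qed.

Let T_br_eq z c b c' b' : br c b = br c' b' -> T z c b = T z c' b'.
Proof. by rewrite /T => ->. Qed.

Section Pair.
Variables x y : V.
Let a := br x y.
Hypothesis th_a : th a = 1.

(* With m = dim [x, V] and t = dim ([x, V] :&: [y, V]), ci a is the identity on
   F1, of dimension dim V - m + t, and maps Om, of dimension at least m, into the
   line of a. Hence its kernel Z has dimension at least m - 1 and at most m - t,
   which forces t = 1, dim Z = m - 1 and V = F1 (+) Z. *)
Let F1 := (br x @^-1: (limg (br x) :&: limg (br y)))%VS.
Let Z := lker (ci a).

Let a_neq0 : a != 0.
Proof. by apply/eqP=> a0; have/eqP := th_a; rewrite a0 linear0 eq_sym oner_eq0. Qed.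

(** Membership in [F1] means [[x, z] = [y, s]] for some [s], and [T z c b] depends on [c], [b] only
    through [[c, b]]; hence T(z,x,y) = -T(y,x,z) = -T(y,y,s) = 0. *)
Lemma ci_br_id z : z \in F1 -> ci a z = z.
Proof.
rewrite -memv_preim => /memv_capP[_ /memv_imgP[s _ eqs]].
rewrite ciC ciE -/a th_a scale1r -/(T z x y) Trot Trot TC23.
by rewrite (@T_br_eq y x z y s) ?Txx ?oppr0 ?addr0.
Qed.

Let Q := (br a @^-1: (limg (br a) :&: limg (br x)))%VS.
Let Om := (br x @: Q + limg (br a))%VS.

(** On the image of [br a] this is [ci_br]. For [q] in [Q] with [[a, q] = [x, s']], T(a,x,q) =
    -T(x,a,q) = -T(x,x,s') = 0. *)
Let ci_Om : (ci a @: Om <= <[a]>)%VS.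
Proof.
apply/subvP=> _ /memv_imgP[_ /memv_addP[_ /memv_imgP[q Qq ->]
  [_ /memv_imgP[s _ ->] ->]] ->].
rewrite linearD /= ci_br memvD ?memvZ ?memv_line //.
move: Qq; rewrite -memv_preim => /memv_capP[_ /memv_imgP[s' _ eqs]].
rewrite ciE TC12 (@T_br_eq x a q x s') // Txx oppr0 addr0.
by rewrite memvZ ?memv_line.
Qed.

Let dim_preim (f : 'End(V)) W : (W <= limg f)%VS ->
  (\dim (lker f) + \dim W = \dim (f @^-1: W))%N.
Proof.
move=> sW; rewrite -(limg_ker_dim f (f @^-1: W)) lpreimK //.
by congr (\dim _ + _)%N; apply/esym/capv_idPr; rewrite -lpreim0 lpreimS ?sub0v.
Qed.

Lemma br_pair_dims :
  [/\ (\dim Z).+1 = \dim (limg (br x)),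
      (limg (br x) :&: limg (br y))%VS = <[a]>%VS,
      (F1 + Z)%VS = fullv, (F1 :&: Z = 0)%VS & a \in limg (ci a)].
Proof.
have FZ0 : (F1 :&: Z = 0)%VS.
  apply/eqP; rewrite -subv0; apply/subvP=> z /memv_capP[/ci_br_id Fz].
  by rewrite memv_ker Fz memv0.
(* Why dim Om >= m: put n = dim V and c = dim ([a, V] :&: [x, V]). Then dim Q = n - dim [a, V] + c,
   the image of [Q] under [br x] has dimension at least dim Q - (n - m), and it meets [a, V] in
   dimension at most c. *)
have dF := dim_preim (capvSl (limg (br x)) (limg (br y))).
have dQ := dim_preim (capvSl (limg (br a)) (limg (br x))).
have dx := limg_ker_dim (br x) fullv; rewrite capfv in dx.
have da := limg_ker_dim (br a) fullv; rewrite capfv in da.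
have dE := limg_ker_dim (br x) Q.
have dE' : (\dim (Q :&: lker (br x)) <= \dim (lker (br x)))%N by rewrite dimvS ?capvSr.
have dO := dimv_sum_cap (br x @: Q) (limg (br a)).
have dO' : (\dim (br x @: Q :&: limg (br a)) <= \dim (limg (br a) :&: limg (br x)))%N.
  by rewrite dimvS // capvC capvS // limgS ?subvf.
have dK := limg_ker_dim (ci a) Om.
have dK1 : (\dim (ci a @: Om) <= 1)%N.
  by rewrite (leq_trans (dimvS ci_Om)) // dim_vline leq_b1.
have dK2 : (\dim (Om :&: lker (ci a)) <= \dim Z)%N by rewrite dimvS ?capvSr.
have dFZ := dimv_disjoint_sum FZ0.
have dFZ' : (\dim (F1 + Z) <= \dim {:V})%N by rewrite dimvS ?subvf.
have a_cap : (<[a]> <= limg (br x) :&: limg (br y))%VS.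
  rewrite -memvE memv_cap memv_img ?memvf //=.
  by rewrite /a brC memvN memv_img ?memvf.
have da1 : (\dim <[a]> = 1)%N by rewrite dim_vline a_neq0.
have dcap := dimvS a_cap.
rewrite -/F1 -/Q -/Om in dF dQ dO dK dK2.
split=> //.
- lia.
- by apply/esym/eqP; rewrite eqEdim a_cap; lia.
- by apply/eqP; rewrite eqEdim subvf; lia.
(* If [ci a] vanished on [Om], then [Z] would have dimension at least m instead of m - 1; so the
   image of [Om] is the whole line of [a]. *)
apply: (subvP (limgS (ci a) (subvf Om))).
have /eqP -> : (ci a @: Om)%VS == <[a]>%VS by rewrite eqEdim ci_Om; lia.
exact: memv_line.
Qed.

Lemma mem_br_ker z : z \in F1 -> z \in Z -> z = 0.
Proof.
move=> Fz Zz; apply/eqP; have [_ _ _ F0 _] := br_pair_dims.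
by rewrite -memv0 -F0 memv_cap Fz.
Qed.

(** Being the identity on [F1] and zero on [Z], [ci a] is the projection onto [F1] along [Z]. *)
Lemma ci_img_F1 z : ci a z \in F1.
Proof.
have [_ _ FZ _ _] := br_pair_dims.
have /memv_addP[f Ff [w Zw ->]] : z \in (F1 + Z)%VS by rewrite FZ memvf.
by move: Zw; rewrite memv_ker linearD /= (ci_br_id Ff) => /eqP ->; rewrite addr0.
Qed.

(** As [a] is in the image of [ci a], it lies in [F1], so [[x, a]] lies in [x, V] :&: [y, V], which
    is the line of [a]. *)
Lemma br_stable : exists mu, br x a = mu *: a.
Proof.
have [_ dxy _ _ /memv_imgP[z _ az]] := br_pair_dims.
have: a \in F1 by rewrite az ci_img_F1.
by rewrite -memv_preim dxy => /vlineP.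
Qed.

End Pair.

Let thf : 'Hom(V, K^o) := linfun (th : V -> K^o).
Let thfE z : thf z = th z. Proof. by rewrite lfunE. Qed.

Let dim_ker_th U : (\dim U <= (\dim (U :&: lker thf)).+1)%N.
Proof.
have := limg_ker_dim thf U.
have : (\dim (thf @: U) <= 1)%N by rewrite (leq_trans (dimvS (subvf _))) ?dimvf.
lia.
Qed.

(** Since [[x, a] = 0], the kernel Z of [ci a] is the part of [x, V] killed by [th]. If nu = 0, the
    part of [y, V] killed by [th] also lies in Z, hence in [x, V] :&: [y, V], the line of [a], where
    [th] is injective; so dim [y, V] <= 1 and Z = 0. If nu <> 0, [ciay] shows that nu z is in [F1]
    for every z in Z. *)
Lemma ker_ci_eq0 x y nu : th (br x y) = 1 ->
  br x (br x y) = 0 -> br y (br x y) = nu *: br x y -> lker (ci (br x y)) = 0%VS.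
Proof.
set a := br x y => th_a xa ya.
have [dZ dxy FZ F0 _] := br_pair_dims th_a.
rewrite -/a in dZ FZ F0 dxy *.
have sub (U : {vspace V}) : (forall u, u \in U -> th u = 0 -> ci a u = 0) -> (U :&: lker thf <= lker (ci a))%VS.
  move=> HU; apply/subvP=> u /memv_capP[Uu]; rewrite !memv_ker thfE => /eqP u0.
  by rewrite HU.
have Zx : (limg (br x) :&: lker thf)%VS = lker (ci a).
  apply/eqP; rewrite eqEdim sub ?andTb; first by have := dim_ker_th (limg (br x)); lia.
  move=> _ /memv_imgP[z _ ->] th0.
  by rewrite ciE TC12 TC23 opprK Trot T0 ?addr0 ?th0 ?scale0r // brC xa oppr0.
have ciay z : ci a (br y z) = th (br y z) *: a - nu *: ci a z + nu *: z.
  rewrite ciE -addrA; congr (_ + _).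
  rewrite -Trot TC23 /T ya linearZ /= [th _]linearZ /= th_a mulr1 opprB addrC.
  by rewrite [ci z a]ciC.
have [nu0|nu_neq0] := eqVneq nu 0.
  have dy : (\dim (lker (ci a))).+1 = \dim (limg (br y)).
    have th_a' : th (br y (- x)) = 1 by rewrite linearN -brC.
    have [] := br_pair_dims th_a'.
    by rewrite linearN -brC.
  apply/eqP; rewrite -dimv_eq0.
  have : (limg (br y) :&: lker thf <= 0)%VS.
    apply/subvP=> u /[dup] uyk /memv_capP[uy uk].
    have uZ : u \in lker (ci a).
      apply: (subvP (sub (limg (br y)) _) _ uyk) => _ /memv_imgP[z _ ->] th0.
      by rewrite ciay nu0 th0 !scale0r subrr addr0.
    have : u \in <[a]>%VS.
      by rewrite -dxy memv_cap uy andbT; move: uZ; rewrite -Zx => /memv_capP[].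
    case/vlineP=> k uE; move: uk.
    by rewrite uE memv_ker thfE linearZ /= th_a mulr1 => /eqP ->; rewrite scale0r mem0v.
  rewrite subv0 => /eqP uy0; have := dim_ker_th (limg (br y)); rewrite uy0 dimv0; lia.
apply/eqP; rewrite -subv0; apply/subvP=> z Zz; rewrite memv0; apply/eqP.
apply: (mem_br_ker th_a) => //.
have aF : ci a (br y z) - th (br y z) *: a \in
    (br x @^-1: (limg (br x) :&: limg (br y)))%VS.
  rewrite memvB ?ci_img_F1 // memvZ //.
  by rewrite -memv_preim xa mem0v.
have := aF; rewrite ciay; move: Zz; rewrite memv_ker => /eqP ->.
by rewrite scaler0 subr0 addrC addKr => /(memvZ nu^-1); rewrite scalerA mulVf // scale1r.
Qed.

(** After adjusting the pair to satisfy [ker_ci_eq0], [F1] is the whole space and [ci a] is the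
    identity, so [ci_br] makes every [[a, z]] a multiple of [a]. *)
Lemma bracket_rank1 x y : th (br x y) != 0 -> exists a, forall v w, br v w = th (br v w) *: a.
Proof.
move=> thxy.
have [x' [y' [th1 x'a [nu y'a]]]] : exists x' y', [/\ th (br x' y') = 1,
    br x' (br x' y') = 0 & exists nu, br y' (br x' y') = nu *: br x' y'].
  pose y1 := (th (br x y))^-1 *: y.
  have th1 : th (br x y1) = 1 by rewrite linearZ linearZ /= mulVf.
  have th1' : th (br y1 (- x)) = 1 by rewrite linearN -brC.
  have [mu xa] := br_stable th1.
  have [nu ya] := br_stable th1'.
  rewrite linearN -brC in ya.
  (* Change the pair but not its bracket, so that its first member commutes with the bracket: swap
     the two up to sign, or subtract a multiple of [y1] from [x]. *)
  have [nu0|nu0] := eqVneq nu 0.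
    exists y1, (- x); rewrite linearN -brC ya nu0 scale0r; split=> //.
    by exists (- mu); rewrite [LHS]brC linearN opprK [LHS]brC xa scaleNr.
  exists (x - (mu / nu) *: y1), y1.
  have -> : br (x - (mu / nu) *: y1) y1 = br x y1.
    by rewrite brDl -scaleNr brZl brxx scaler0 addr0.
  split=> //; last by exists nu.
  by rewrite brDl -scaleNr brZl xa ya scalerA mulNr divfK // scaleNr subrr.
set a := br x' y' in th1 x'a y'a.
have Z0 := ker_ci_eq0 th1 x'a y'a.
have idf z : ci a z = z.
  apply: ci_br_id => //.
  by have [_ _ FZ _ _] := br_pair_dims th1; move: FZ; rewrite Z0 addv0 => ->; rewrite memvf.
have az z : br a z = th (br a z) *: a by rewrite -[LHS]idf ci_br.
exists a => v w.
(* The error term T(a,v,w) = T(w,a,v) vanishes because [[a, v]] is a multiple of [a] and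
   [ci w a = w]. *)
rewrite -[LHS]idf ciE (Trot a) (Trot v) /T.
by rewrite az linearZ /= [ci w a]ciC idf [th (_ *: a)]linearZ /= th1 mulr1 subrr addr0.
Qed.

End LinearFunctional.

Lemma linfunE (K : fieldType) (aT rT : vectType K) (f : aT -> rT) :
  linear f -> linfun f =1 f.
Proof.
move=> lf; pose g : {linear aT -> rT} := HB.pack f (GRing.isLinear.Build K aT rT _ f lf).
exact: (lfunE g).
Qed.

(* Adjoining to V a central direction whose coordinate in [u, v] is w u v turns w
   into a linear functional of the bracket. *)
Lemma bilinear_bracket_rank1 (K : fieldType) (V : vectType K) (br ci : V -> 'End(V))
    (w : V -> {scalar V}) :
    (forall x, br x x = 0) -> (forall x y, br x y = - br y x) ->
    (forall x, w x x = 0) -> (forall x y, w x y = - w y x) ->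
    (forall x y, ci x y = ci y x) -> (forall a b, ci a (br a b) = w a b *: a) ->
  forall x y, w x y != 0 ->
  exists2 e, e != 0 & forall u v, br u v = w u v *: e.
Proof.
move=> brxx brC wxx wC ciC ci_br x y wxy.
pose V1 := (V * K^o)%type.
pose br1f (a b : V1) : V1 := (br a.1 b.1, w a.1 b.1).
(* The product of the added coordinates is what [ci1_br] requires in the second component. *)
pose ci1f (a b : V1) : V1 := (ci a.1 b.1, a.2 * b.2).
have br1L a : linear (br1f a).
  by move=> k u v; rewrite /br1f !linearP.
have ci1L a : linear (ci1f a).
  by move=> k u v; rewrite /ci1f !linearP /= mulrDr mulrCA.
pose br1 a := linfun (br1f a); pose ci1 a := linfun (ci1f a).
have br1E a b : br1 a b = br1f a b by rewrite linfunE.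
have ci1E a b : ci1 a b = ci1f a b by rewrite linfunE.
have thL : scalar (fun a : V1 => a.2 : K) by [].
pose th : {scalar V1} := HB.pack (fun a : V1 => a.2 : K)
  (GRing.isLinear.Build K V1 K _ (fun a : V1 => a.2 : K) thL).
have br1xx a : br1 a a = 0 by rewrite br1E /br1f brxx wxx.
have br1C a b : br1 a b = - br1 b a by rewrite !br1E /br1f brC wC.
have ci1C a b : ci1 a b = ci1 b a by rewrite !ci1E /ci1f ciC mulrC.
have ci1_br a b : ci1 a (br1 a b) = th (br1 a b) *: a.
  by rewrite ci1E br1E /ci1f /br1f ci_br /= [a.2 * _]mulrC; case: a.
have th1 : th (br1 (x, 0) (y, 0)) != 0 by rewrite br1E.
have [e eP] := bracket_rank1 br1xx br1C ci1C ci1_br th1.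
have {}eP u v : br u v = w u v *: e.1.
  by have := eP (u, 0) (v, 0); rewrite !br1E => -[].
exists e.1 => //; apply/eqP => e0; move/eqP: (wxy); apply.
have x0 : x = 0.
  apply/eqP; have := ci_br x y; rewrite eP e0 scaler0 linear0 => /esym/eqP.
  by rewrite scaler_eq0; case/orP=> // /eqP wx0; rewrite wx0 eqxx in wxy.
by rewrite x0 wC linear0 oppr0.
Qed.

(** * Tensors of degree 3 and the relations coming from the power map *)

Section Tensors.
Variables (K : fieldType) (d : nat).
Let I3 : finType := ('I_d * 'I_d * 'I_d)%type.
Let I2 : finType := ('I_d * 'I_d)%type.
Implicit Types (v a b c : 'rV[K]_d) (t w : 'M[K]_d).

(* The tensors t (x) v and v (x) t, and their difference [t, v]. *)
Definition tensl t v : 'rV[K]_#|I3| :=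
  \row_s (t (enum_val s).1.1 (enum_val s).1.2 * v 0 (enum_val s).2).
Definition tensr v t : 'rV[K]_#|I3| :=
  \row_s (v 0 (enum_val s).1.1 * t (enum_val s).1.2 (enum_val s).2).
Definition lie t v := tensl t v - tensr v t.

Lemma tensl_is_linear t : linear (tensl t).
Proof. by move=> k u v; apply/rowP=> s; rewrite !mxE mulrDr mulrCA. Qed.
HB.instance Definition _ t :=
  GRing.isLinear.Build K _ _ _ (tensl t) (@tensl_is_linear t).
Lemma tensr_is_linear v : linear (tensr v).
Proof. by move=> k u t; apply/rowP=> s; rewrite !mxE mulrDr mulrCA. Qed.
HB.instance Definition _ v :=
  GRing.isLinear.Build K _ _ _ (tensr v) (@tensr_is_linear v).
Lemma tenslDl t u v : tensl (t + u) v = tensl t v + tensl u v.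
Proof. by apply/rowP=> s; rewrite !mxE mulrDl. Qed.
Lemma tensrDl u v t : tensr (u + v) t = tensr u t + tensr v t.
Proof. by apply/rowP=> s; rewrite !mxE mulrDl. Qed.
Lemma tenslrA a b c : tensr a (b^T *m c) = tensl (a^T *m b) c.
Proof. by apply/rowP=> s; rewrite !mxE !big_ord1 !mxE mulrA. Qed.

Definition form w a b : K := (a *m w *m b^T) 0 0.

Lemma formE w a b : form w a b = \sum_i \sum_j a 0 i * w i j * b 0 j.
Proof.
rewrite /form mxE exchange_big; apply: eq_bigr => j _.
by rewrite !mxE big_distrl; apply: eq_bigr => i _.
Qed.

Lemma form_is_linear w a : scalar (form w a).
Proof. by move=> k u v; rewrite /form linearP /= mulmxDr -scalemxAr !mxE. Qed.
HB.instance Definition _ w a :=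
  GRing.isLinear.Build K _ _ _ (form w a) (@form_is_linear w a).

Lemma form_tr w a b : form w a b = form w^T b a.
Proof. by rewrite /form -(mxE trmx_key (fun i j => (b *m w^T *m a^T) j i)) -/(trmx _) !trmx_mul !trmxK mulmxA. Qed.

Definition dot a b : K := (a *m b^T) 0 0.

Lemma dotE a b : dot a b = \sum_i a 0 i * b 0 i.
Proof. by rewrite /dot mxE; apply: eq_bigr => i _; rewrite mxE. Qed.

(* Evaluation of a tensor at the linear forms a, b, c. *)
Definition ev a b c (u : 'rV[K]_#|I3|) : K := (u *m (tensl (a^T *m b) c)^T) 0 0.

Lemma ev_is_linear a b c : scalar (ev a b c).
Proof. by move=> k u v; rewrite /ev mulmxDl -scalemxAl !mxE. Qed.
HB.instance Definition _ a b c :=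
  GRing.isLinear.Build K _ _ _ (ev a b c) (@ev_is_linear a b c).

Lemma evE a b c (F : I3 -> K) :
  ev a b c (\row_s F (enum_val s)) =
  \sum_i \sum_j \sum_m F (i, j, m) * (a 0 i * b 0 j * c 0 m).
Proof.
rewrite /ev mxE; under eq_bigr do rewrite !mxE big_ord1 !mxE.
rewrite pair_big pair_big /=.
rewrite [RHS](reindex (@enum_val I3 predT)) /=; last exact: onW_bij (enum_val_bij _).
by apply: eq_bigr => s _; case: (enum_val s) => -[].
Qed.

Lemma ev_tensl a b c t v : ev a b c (tensl t v) = form t a b * dot v c.
Proof.
rewrite (evE _ _ _ (fun s => t s.1.1 s.1.2 * v 0 s.2)) formE dotE big_distrl /=.
apply: eq_bigr => i _; rewrite big_distrl /=; apply: eq_bigr => j _.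
by rewrite big_distrr /=; apply: eq_bigr => m _; ring.
Qed.

Lemma ev_tensr a b c t v : ev a b c (tensr v t) = dot v a * form t b c.
Proof.
rewrite (evE _ _ _ (fun s => v 0 s.1.1 * t s.1.2 s.2)) formE dotE big_distrl /=.
apply: eq_bigr => i _; rewrite big_distrr /=; apply: eq_bigr => j _.
by rewrite big_distrr /=; apply: eq_bigr => m _; ring.
Qed.

Lemma form_skew t a b : t^T = - t -> form t a b = - form t b a.
Proof. by move=> tN; rewrite form_tr tN /form mulmxN mulNmx mxE. Qed.

Lemma ev_lie a b t v : t^T = - t ->
  ev a b a (lie t v) = 2%:R * (form t a b * dot v a).
Proof.
move=> tN; rewrite [ev _ _ _ _]linearB /= ev_tensl ev_tensr.
by rewrite (form_skew b a tN); ring.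
Qed.

Lemma lieDl t u v : lie (t + u) v = lie t v + lie u v.
Proof. by rewrite /lie tenslDl linearD opprD addrACA. Qed.

Lemma lie_is_linear t : linear (lie t).
Proof.
move=> k u v; apply/rowP=> s; rewrite !mxE; ring.
Qed.

Variable f : 'I_d -> 'M[K]_d.

(** The polarised form of the relations [[f x, x]]; both span the same space when 2 is
    invertible. *)
Definition power_rel : 'M[K]_(#|I2|, #|I3|) :=
  \matrix_s (lie (f (enum_val s).1) (delta_mx 0 (enum_val s).2) +
             lie (f (enum_val s).2) (delta_mx 0 (enum_val s).1)).

Lemma dot_delta j a : dot (delta_mx 0 j) a = a 0 j.
Proof.
rewrite dotE (bigD1 j) //= big1 ?addr0 => [|i ij]; rewrite !mxE eqxx.
  by rewrite eqxx mul1r.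
by rewrite (negPf ij) mul0r.
Qed.

Lemma form_delta w i j : form w (delta_mx 0 i) (delta_mx 0 j) = w i j.
Proof. by rewrite /form -rowE trmx_delta -colE !mxE. Qed.

(** Row vectors now stand for linear forms on V. Write [[w, e_l]] as a combination of the relations,
    with coefficients [M l], and evaluate at (a, b, a): by [ev_lie] one side is 2 w(a,b) a_l, the
    other is twice the [l]-th coordinate of [cif a (brf a b)], where [cif] symmetrises the forms
    [M l]. *)
Lemma power_rel_rank1 (w : 'M[K]_d) :
    2%:R != 0 :> K -> (forall i, (f i)^T = - f i) -> w^T = - w -> w != 0 ->
    (forall l, (lie w (delta_mx 0 l) <= power_rel)%MS) ->
  exists2 e : 'rV[K]_d, e != 0 & forall i, f i = e 0 i *: w.
Proof.
move=> nz2 fN wN w0 wB.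
have /fin_all_exists[D DE] l : exists D, lie w (delta_mx 0 l) = D *m power_rel.
  exact: submxP.
pose M l : 'M[K]_d := \matrix_(i, j) D l 0 (enum_rank (i, j)).
pose brf a b : 'rV[K]_d := \row_i form (f i) a b.
pose cif a b : 'rV[K]_d := \row_l (form (M l) a b + form (M l) b a).
have brL a : linear (brf a) by move=> k u v; apply/rowP=> i; rewrite !mxE linearP.
have formL t b k u v : form t (k *: u + v) b = k * form t u b + form t v b.
  by rewrite !(form_tr t _ b) linearP.
have ciL a : linear (cif a).
  by move=> k u v; apply/rowP=> l; rewrite !mxE linearP formL /=; ring.
have sk0 t a : t^T = - t -> form t a a = 0.
  move=> /(form_skew a a)/eqP; rewrite -subr_eq0 opprK -mulr2n -mulr_natl.
  by rewrite mulf_eq0 (negPf nz2) => /eqP.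
have cibr a b : cif a (brf a b) = form w a b *: a.
  apply/rowP=> l; rewrite !mxE; apply: (mulfI nz2).
  transitivity (ev a b a (lie w (delta_mx 0 l))); last first.
    by rewrite ev_lie // dot_delta.
  rewrite DE mulmx_sum_row linear_sum /=.
  transitivity (\sum_(s : I2) M l s.1 s.2 *
      (2%:R * (form (f s.1) a b * a 0 s.2 + form (f s.2) a b * a 0 s.1))).
    rewrite -(pair_big predT predT (fun i j => M l i j * (2%:R *
      (form (f i) a b * a 0 j + form (f j) a b * a 0 i)))) /=.
    rewrite !(formE (M l)) -big_split big_distrr /=; apply: eq_bigr => i _.
    rewrite -big_split big_distrr /=; apply: eq_bigr => j _.
    by rewrite !mxE; ring.
  rewrite (reindex (@enum_val I2 predT)) /=; last exact: onW_bij (enum_val_bij _).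
  apply: eq_bigr => s _; rewrite [ev _ _ _ _]linearZ /= rowK [ev _ _ _ _]linearD /=.
  by rewrite !ev_lie // !dot_delta mxE -surjective_pairing enum_valK mulrDr.
case: (pickP (fun s : I2 => w s.1 s.2 != 0)) => [[i j] /= wij|w00]; last first.
  case/eqP: w0; apply/matrixP=> i j; rewrite mxE.
  by have /negbFE/eqP := w00 (i, j).
rewrite -form_delta in wij.
pose br a := linfun (brf a); pose ci a := linfun (cif a).
have brE a b : br a b = brf a b by rewrite linfunE.
have ciE a b : ci a b = cif a b by rewrite linfunE.
have brxx a : br a a = 0 by rewrite brE; apply/rowP=> l; rewrite !mxE sk0.
have brC a b : br a b = - br b a.
  by rewrite !brE; apply/rowP=> l; rewrite !mxE form_skew.
have ciC a b : ci a b = ci b a by rewrite !ciE; apply/rowP=> l; rewrite !mxE addrC.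
have cibr' a b : ci a (br a b) = form w a b *: a by rewrite ciE brE cibr.
have [e e0 eP] := @bilinear_bracket_rank1 K 'rV[K]_d br ci (fun a => form w a)
  brxx brC (fun a => sk0 w a wN) (fun a b => form_skew a b wN) ciC cibr' _ _ wij.
exists e => // l; apply/matrixP=> s t; rewrite !mxE.
have := eP (delta_mx 0 s) (delta_mx 0 t); rewrite brE => /rowP/(_ l).
by rewrite !mxE /= !form_delta mulrC.
Qed.

End Tensors.

(** * Coordinates on H *)

Section ZpSquare.
Variable p : nat.
Hypothesis p_pr : prime p.
Local Notation F := 'F_p.
Local Notation R := 'Z_(p ^ 2).

Let p_gt0 : (0 < p)%N. Proof. exact: prime_gt0. Qed.
Let p_gt1 : (1 < p)%N. Proof. exact: prime_gt1. Qed.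
Let p2_gt1 : (1 < p ^ 2)%N. Proof. by rewrite (ltn_exp2l 0). Qed.

Definition red (r : R) : F := (r : nat)%:R.
(** With [red] this forms the extension of F_p by F_p with middle term Z/p^2; its image is the set
    of multiples of [p]. *)
Definition iota_p (u : F) : R := (p * u)%:R.

Lemma Fp_natE n : (n%:R : F) = (n %% p)%N :> nat.
Proof. by rewrite val_Fp_nat. Qed.

Lemma Zp2_natE n : (n%:R : R) = (n %% (p ^ 2))%N :> nat.
Proof. by rewrite val_Zp_nat. Qed.

Lemma Fp_natK (u : F) : (u : nat)%:R = u.
Proof. exact: natr_Zp. Qed.

Lemma Zp2_natK (r : R) : (r : nat)%:R = r.
Proof. exact: natr_Zp. Qed.

Lemma Fp_nat_eq m n : (m = n %[mod p])%N -> m%:R = n%:R :> F.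
Proof. by move=> e; apply: val_inj; rewrite /= !Fp_natE e. Qed.

Lemma Zp2_nat_eq m n : (m = n %[mod p ^ 2])%N -> m%:R = n%:R :> R.
Proof. by move=> e; apply: val_inj; rewrite /= !Zp2_natE e. Qed.

Lemma red_nat n : red n%:R = n%:R.
Proof.
rewrite /red Zp2_natE; apply: Fp_nat_eq.
by rewrite modn_dvdm // dvdn_mulr // -[p in (p %| _)%N]expn1 dvdn_exp2l.
Qed.

Lemma redD r s : red (r + s) = red r + red s.
Proof. by rewrite -[r]Zp2_natK -[s]Zp2_natK -natrD !red_nat natrD. Qed.

Lemma iota_p_nat n : iota_p n%:R = (p * n)%:R.
Proof. by apply: Zp2_nat_eq; rewrite Fp_natE expnS expn1 -!muln_modr // modn_mod. Qed.

Lemma iota_pD u v : iota_p (u + v) = iota_p u + iota_p v.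
Proof. by rewrite -[u]Fp_natK -[v]Fp_natK -natrD !iota_p_nat mulnDr natrD. Qed.

Lemma iota_pM u r : iota_p u * r = iota_p (u * red r).
Proof. by rewrite -[u]Fp_natK -[r]Zp2_natK red_nat -natrM !iota_p_nat -natrM mulnA. Qed.

Lemma red_iota u : red (iota_p u) = 0.
Proof. by rewrite red_nat natrM pchar_Fp_0 // mul0r. Qed.

Lemma iota_p_eq0 u : iota_p u = 0 -> u = 0.
Proof.
move=> /(congr1 val); rewrite /= Zp2_natE => e.
have: (p ^ 2 %| p * u)%N by apply/eqP.
rewrite expnS expn1 dvdn_pmul2l // => pu.
by rewrite -[u]Fp_natK; apply: (@Fp_nat_eq _ 0); apply/eqP; rewrite mod0n.
Qed.

Lemma red_eq0 r : red r = 0 -> exists u, r = iota_p u.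
Proof.
move=> /(congr1 val); rewrite /= Fp_natE => /eqP/dvdnP[k rk].
by exists k%:R; rewrite iota_p_nat mulnC -rk Zp2_natK.
Qed.
End ZpSquare.

Lemma group_hom_prod (gT : finGroupType) (H : {group gT}) (V : zmodType)
    (g : gT -> V) n (F : 'I_n -> gT) :
    (forall x y, x \in H -> y \in H -> g (x * y)%g = g x + g y) ->
    (forall i, F i \in H) ->
  g (\prod_i F i)%g = \sum_i g (F i).
Proof.
move=> gM; elim: n F => [|n IHn] F HF.
  rewrite !big_ord0; apply: (addrI (g 1%g)).
  by rewrite -gM ?group1 // mulg1 addr0.
by rewrite !big_ord_recr /= gM ?IHn ?group_prod.
Qed.

(** Lifts of generators of the Frattini quotient generate [G] together with ['Phi(G)], which
    consists of non-generators. *)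
Lemma grank_quotient_Phi (gT : finGroupType) (G : {group gT}) :
  ('m(G) <= 'm(G / 'Phi(G)))%N.
Proof.
have [B genB cardB] := grank_witness (G / 'Phi(G))%G.
have BG b : b \in B -> exists2 x, x \in G & b = coset 'Phi(G) x.
  move=> Bb; have : b \in (G / 'Phi(G))%g by rewrite -genB mem_gen.
  by case/morphimP=> x _ Gx ->; exists x.
pose r b := odflt 1%g [pick x in G | b == coset 'Phi(G) x].
have rP b : b \in B -> (r b \in G) && (b == coset 'Phi(G) (r b)).
  move=> /BG[x Gx bx]; rewrite /r; case: pickP => [z //|/(_ x)].
  by rewrite Gx bx eqxx.
have rG : r @: B \subset G by apply/subsetP=> _ /imsetP[b /rP/andP[Gb _] ->].
rewrite -[X in ('m(X) <= _)%N](_ : <<r @: B>>%g = G).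
  by rewrite (leq_trans (grank_min _)) // -cardB leq_imset_card.
apply: Phi_nongen; apply/eqP; rewrite eqEsubset join_subG Phi_sub rG /=.
rewrite -(@quotientSGK _ 'Phi(G)%G) ?gFnorm ?joing_subl // -genB gen_subG.
apply/subsetP=> b Bb; have /andP[_ /eqP {1}->] := rP b Bb.
by rewrite mem_quotient // mem_gen // inE imset_f ?orbT.
Qed.

Section Coordinates.
Variables (p d : nat) (gT : finGroupType) (H : {group gT}).
Hypotheses (p_pr : prime p) (p_neq2 : (p != 2)%N) (spH : special_pgroup p H).
Let W := H^`(1)%G.

Let abelW : p.-abelem W. Proof. by case: spH. Qed.
Let ntW : W :!=: 1%g.
Proof. by case: spH => _ + _ _; apply: contraNneq => W1; apply/derG1P. Qed.

Definition der_rV := abelem_rV abelW ntW.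
Definition rV_der := rVabelem abelW ntW.
Local Notation n := (abelem_dim' W).+1.

Lemma der_rVM x y : x \in H^`(1)%g -> y \in H^`(1)%g ->
  der_rV (x * y)%g = der_rV x + der_rV y.
Proof. exact: abelem_rV_M. Qed.

Lemma der_rVX x k : x \in H^`(1)%g -> der_rV (x ^+ k)%g = k%:R *: der_rV x.
Proof. exact: abelem_rV_X. Qed.

Lemma rV_derK x : x \in H^`(1)%g -> rV_der (der_rV x) = x.
Proof. exact: abelem_rV_K. Qed.

Lemma rV_derD u v : rV_der (u + v) = (rV_der u * rV_der v)%g.
Proof. exact: rVabelemD. Qed.

Lemma mem_rV_der u : rV_der u \in H^`(1)%g.
Proof. exact: mem_rVabelem. Qed.

Lemma der_rV_commMr x y z : x \in H -> y \in H -> z \in H ->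
  der_rV [~ x, y * z]%g = der_rV [~ x, y]%g + der_rV [~ x, z]%g.
Proof.
move=> Hx Hy Hz; rewrite commgMJ.
have -> : ([~ x, y] ^ z = [~ x, y])%g.
  by rewrite conjgE -(der_commute spH Hz (comm_der Hx Hy)) mulKg.
by rewrite der_rVM ?comm_der // addrC.
Qed.

Lemma rV_der_commute u x : x \in H -> commute (rV_der u) x.
Proof. by move=> Hx; apply/commute_sym/(der_commute spH Hx)/mem_rV_der. Qed.

(** Collection in class 2: [G j] moves left past each [F i] with [i > j], and the resulting
    commutators are central. *)
Lemma prod_mul_prod m (F G : 'I_m -> gT) :
    (forall i, F i \in H) -> (forall i, G i \in H) ->
  ((\prod_i F i) * (\prod_i G i) = (\prod_i (F i * G i)) *
    rV_der (\sum_(i < m) \sum_(j < m | (j < i)%N) der_rV [~ F i, G j]))%g.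
Proof.
elim: m F G => [|m IHm] F G HF HG.
  by rewrite !big_ord0 /rV_der rVabelem0.
rewrite !big_ord_recr /=.
set PF := (\prod_(i < m) _)%g; set PG := (\prod_(i < m) _)%g.
have HPF : PF \in H by rewrite group_prod.
have HPG : PG \in H by rewrite group_prod.
have Fm := HF ord_max; have Gm := HG ord_max.
transitivity (PF * PG * (F ord_max * G ord_max) * [~ F ord_max, PG])%g.
  rewrite -!mulgA; congr (_ * _)%g.
  rewrite (der_commute spH Gm (comm_der Fm HPG)).
  have := commgC (F ord_max) PG; move: [~ _, _]%g => c cE.
  by rewrite [LHS]mulgA [(F _ * PG)%g]cE -!mulgA.
rewrite IHm //; set Q := (\prod_(i < m) _)%g; set r1 := rV_der _; set r2 := rV_der _.
have -> : r2 = (r1 * [~ F ord_max, PG])%g.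
  rewrite /r1 /r2 -{1}(rV_derK (comm_der Fm HPG)) -rV_derD; congr (rV_der (_ + _)).
    apply: eq_bigr => i _; rewrite big_mkcond big_ord_recr /= -big_mkcond /=.
    by rewrite ltnNge (ltnW (ltn_ord i)) addr0.
  rewrite (@group_hom_prod _ H _ (fun z => der_rV [~ F ord_max, z]%g)) //; last first.
    by move=> *; rewrite der_rV_commMr.
  rewrite big_mkcond big_ord_recr /= ltnn addr0.
  by apply: eq_bigr => j _; rewrite ltn_ord.
have cr : commute r1 (F ord_max * G ord_max)%g by apply: rV_der_commute; rewrite groupM.
by rewrite -(mulgA Q r1) cr !mulgA.
Qed.

Lemma der_Phi : 'Phi(H) = H^`(1)%g.
Proof. by case: spH => _ _ [-> ->]. Qed.

Lemma abel_quo : p.-abelem (H / H^`(1))%g.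
Proof. by rewrite -der_Phi; apply: Phi_quotient_abelem; case: spH. Qed.

Lemma exp_der h : h \in H -> (h ^+ p)%g \in H^`(1)%g.
Proof.
move=> Hh; have nHh : h \in 'N(H^`(1))%g by rewrite (subsetP (der_norm 1 H)).
apply: coset_idr; first by rewrite groupX.
rewrite morphX //; have /abelemP[//|_] := abel_quo.
by apply; rewrite mem_quotient.
Qed.

Lemma exp_p_square h : h \in H -> (h ^+ (p ^ 2))%g = 1%g.
Proof. by move=> Hh; rewrite expnS expn1 expgM (der_exp p_pr spH) ?exp_der. Qed.

Variable x : 'I_d -> gT.
Hypothesis genx : <<[set x i | i in 'I_d]>>%g = H.
Hypothesis cardW : #|H^`(1)%g| = (p ^ (d * (d - 1))./2)%N.
Hypothesis grH : 'm(H) = d.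

Let Hx i : x i \in H.
Proof. by rewrite -genx mem_gen // imset_f. Qed.

(* Every element of H is gen_prod v * comm_prod T; v is a vector over Z/p^2 since
   the exponent of H may be p^2. Only the entries of T below the diagonal matter. *)
Definition gen_prod (v : 'rV['Z_(p ^ 2)]_d) : gT := (\prod_i x i ^+ (v 0%R i : nat))%g.
Definition comm_vec (T : 'M['F_p]_d) : 'rV['F_p]_n :=
  \sum_(i < d) \sum_(j < d | (j < i)%N) T i j *: der_rV [~ x i, x j]%g.
Definition comm_prod T := rV_der (comm_vec T).

Lemma comm_vecD T U : comm_vec (T + U) = comm_vec T + comm_vec U.
Proof.
rewrite /comm_vec -big_split; apply: eq_bigr => i _; rewrite -big_split.
by apply: eq_bigr => j _; rewrite mxE scalerDl.
Qed.

Lemma comm_vecZ k T : comm_vec (k *: T) = k *: comm_vec T.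
Proof.
rewrite /comm_vec scaler_sumr; apply: eq_bigr => i _; rewrite scaler_sumr.
by apply: eq_bigr => j _; rewrite mxE scalerA.
Qed.

Lemma eq_comm_vec (T U : 'M['F_p]_d) : (forall i j : 'I_d, (j < i)%N -> T i j = U i j) -> comm_vec T = comm_vec U.
Proof. by move=> eTU; apply: eq_bigr => i _; apply: eq_bigr => j /eTU->. Qed.

Lemma comm_vec0 : comm_vec 0 = 0.
Proof. by apply: (addrI (comm_vec 0)); rewrite -comm_vecD !addr0. Qed.

Lemma comm_prod0 : comm_prod 0 = 1%g.
Proof. by rewrite /comm_prod comm_vec0 /rV_der rVabelem0. Qed.

Lemma comm_prodD T U : comm_prod (T + U) = (comm_prod T * comm_prod U)%g.
Proof. by rewrite /comm_prod comm_vecD rV_derD. Qed.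

Lemma mem_gen_prod v : gen_prod v \in H.
Proof. by rewrite group_prod // => i _; rewrite groupX. Qed.

Lemma exp_Zp2 h (r s : 'Z_(p ^ 2)) : h \in H ->
  (h ^+ (r + s)%R = h ^+ r * h ^+ s)%g.
Proof.
move=> Hh; have -> : (r + s)%R = ((r : nat) + (s : nat))%:R :> 'Z_(p ^ 2).
  by rewrite natrD !Zp2_natK.
by rewrite Zp2_natE // expg_mod ?exp_p_square // expgD.
Qed.

Definition redv (v : 'rV['Z_(p ^ 2)]_d) : 'rV['F_p]_d := map_mx (@red p) v.

Lemma gen_prodM u v : (gen_prod u * gen_prod v = gen_prod (u + v)%R * comm_prod ((redv u)^T *m redv v)%R)%g.
Proof.
rewrite prod_mul_prod; [|by move=> i; rewrite groupX|by move=> i; rewrite groupX].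
congr (_ * rV_der _)%g; first by apply: eq_bigr => i _; rewrite mxE exp_Zp2.
apply: eq_bigr => i _; apply: eq_bigr => j _.
have c k l : commute (x k) [~ x k, x l]%g /\ commute (x l) [~ x k, x l]%g.
  by split; apply: (der_commute spH) => //; apply: comm_der.
rewrite commXXg; [|by case: (c i j)..].
by rewrite der_rVX ?comm_der // !mxE big_ord1 !mxE natrM.
Qed.

(** The values of [comm_prod] form a central subgroup containing the commutators of generators;
    modulo it [H] is abelian. *)
Lemma der_comm_prod z : z \in H^`(1)%g -> exists T, z = comm_prod T.
Proof.
pose K := [set z in H^`(1)%g | [exists T, z == comm_prod T]].
have gK : group_set K.
  apply/group_setP; split=> [|y z' ].
    rewrite inE group1; apply/existsP; exists 0.
    by rewrite comm_prod0.
  move=> /setIdP[Wy /existsP[T /eqP yT]] /setIdP[Wz /existsP[U /eqP zU]].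
  by rewrite inE groupM //; apply/existsP; exists (T + U); rewrite comm_prodD yT zU.
have xK (i j : 'I_d) : (j < i)%N -> [~ x i, x j]%g \in K.
  move=> ji; rewrite inE comm_der //; apply/existsP; exists (delta_mx i j).
  rewrite /comm_prod /comm_vec (bigD1 i) //= (bigD1 j) //= mxE !eqxx scale1r big1 ?addr0; last first.
    by move=> k /andP[_ /negPf kj]; rewrite mxE kj andbF scale0r.
  rewrite big1 ?addr0 ?rV_derK ?comm_der // => k /negPf ki.
  by rewrite big1 // => l _; rewrite mxE ki scale0r.
have xK' i j : [~ x i, x j]%g \in K.
  case: (ltngtP i j) => [ij|ji|/val_inj->]; last by rewrite commgg (group1 (Group gK)).
    by rewrite -invg_comm (groupVr (G := Group gK)) //; apply: xK.
  exact: xK.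
have KW : K \subset H^`(1)%g by apply/subsetP=> ? /setIdP[].
have nK : H \subset 'N(K).
  have : K \subset 'Z(H) by rewrite -(der_center spH).
  by rewrite subsetI centsC => /andP[_ /cents_norm].
have : H^`(1)%g \subset K.
  apply: (der1_min (H := Group gK)) => //.
  rewrite -genx quotient_gen /=; last by rewrite -gen_subG genx.
  rewrite abelian_gen; apply: (@quotient_cents2r _ _ _ (Group gK)); rewrite gen_subG.
  by apply/subsetP=> _ /imset2P[_ _ /imsetP[i _ ->] /imsetP[j _ ->] ->].
by move=> sWK Wz; have /setIdP[_ /existsP[T /eqP ->]] := subsetP sWK _ Wz; exists T.
Qed.

(** The rank hypothesis enters here: [comm_vec] maps the p^(d(d-1)/2) strictly lower triangular
    matrices onto a space with that many elements, hence injectively. *)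
Lemma comm_vec_eq0 T : comm_vec T = 0 -> forall i j : 'I_d, (j < i)%N -> T i j = 0.
Proof.
pose D := [pred s : 'I_d * 'I_d | (s.2 < s.1)%N].
(* Strictly lower triangular matrices, as functions with default value 0 so that [card_pffun_on]
   counts them. *)
pose A := [set g : {ffun 'I_d * 'I_d -> 'F_p} | g \in pffun_on 0 D predT].
pose m (g : {ffun 'I_d * 'I_d -> 'F_p}) : 'M['F_p]_d := \matrix_(i, j) g (i, j).
pose h (T : 'M['F_p]_d) := [ffun s : 'I_d * 'I_d => if (s.2 < s.1)%N then T s.1 s.2 else 0 : 'F_p].
have hA U : h U \in A.
  rewrite inE; apply/pffun_onP; split=> //; apply/subsetP=> s; rewrite !inE /= ffunE.
  by case: ifP => //; rewrite eqxx.
have clh U : comm_vec (m (h U)) = comm_vec U.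
  by apply: eq_comm_vec => i j ji; rewrite mxE ffunE ji.
have cardA : #|A| = (p ^ (d * (d - 1))./2)%N.
  rewrite cardsE card_pffun_on card_Fp //; congr (_ ^ _)%N.
  rewrite -sum1_card (eq_bigl (fun s : 'I_d * 'I_d => true && (s.2 < s.1)%N)) //.
  rewrite -(pair_big_dep predT (fun i j : 'I_d => (j < i)%N) (fun _ _ => 1%N)) /=.
  rewrite (eq_bigr (fun i : 'I_d => i : nat)) => [|i _].
    by rewrite -(big_mkord predT id) bin2_sum bin2 subn1.
  by rewrite -(big_ord_widen d (fun _ => 1%N) (ltnW (ltn_ord i))) sum_nat_const card_ord muln1.
have : {in A &, injective (fun g => comm_vec (m g))}.
  apply/imset_injP; apply/eqP/anti_leq; rewrite leq_imset_card /= cardA -cardW.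
  rewrite -(card_abelem_rV abelW ntW) -cardsT subset_leq_card //.
  apply/subsetP=> u _; have [U uU] := der_comm_prod (mem_rV_der u).
  apply/imsetP; exists (h U) => //; rewrite clh.
  apply: (@rVabelem_inj _ _ _ abelW ntW); exact: uU.
move=> inj T0 i j ji.
have /inj : comm_vec (m (h T)) = comm_vec (m (h 0)).
  by rewrite !clh T0 comm_vec0.
by move=> /(_ (hA _) (hA _))/ffunP/(_ (i, j)); rewrite !ffunE /= ji mxE.
Qed.

Lemma gen_prodP h : h \in H -> exists v T, h = (gen_prod v * comm_prod T)%g.
Proof.
pose K := [set h in H | [exists v, [exists T, h == (gen_prod v * comm_prod T)%g]]].
have gK : group_set K.
  apply/group_setP; split=> [|y z].
    rewrite inE group1; apply/existsP; exists 0; apply/existsP; exists 0.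
    rewrite comm_prod0 mulg1.
    by rewrite /gen_prod big1 // => i _; rewrite mxE.
  move=> /setIdP[Wy /existsP[v /existsP[T /eqP yT]]].
  move=> /setIdP[Wz /existsP[u /existsP[U /eqP zU]]].
  rewrite inE groupM //; apply/existsP; exists (v + u); apply/existsP.
  exists ((redv v)^T *m redv u + (T + U)); rewrite !comm_prodD mulgA -gen_prodM {1}yT {1}zU.
  rewrite -!mulgA; apply/eqP; congr (_ * _)%g; rewrite !mulgA; congr (_ * _)%g.
  exact: (rV_der_commute _ (mem_gen_prod u)).
suff: H \subset K by move=> sHK /(subsetP sHK)/setIdP[_ /existsP[v /existsP[T /eqP]]]; exists v, T.
rewrite -genx (gen_subG _ (Group gK)); apply/subsetP=> _ /imsetP[i _ ->].
rewrite inE Hx; apply/existsP; exists (delta_mx 0 i); apply/existsP; exists 0.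
rewrite comm_prod0 mulg1.
rewrite /gen_prod (eq_bigr (fun k => if k == i then x k else 1%g)) => [|k _].
  by rewrite -big_mkcond big_pred1_eq.
by rewrite mxE eqxx /=; case: eqP.
Qed.

(** The images of the [d] generators span H / H' = H / Phi(H), which has dimension at least
    ['m(H) = d]; so they form a basis and [redv v] is determined by the image of [gen_prod v]. *)
Lemma gen_prod_der v : gen_prod v \in H^`(1)%g -> redv v = 0.
Proof.
have nH : H \subset 'N(H^`(1))%g := der_norm 1 H.
have ntQ : (H / H^`(1))%g != 1%g.
  apply: contra ntW => /eqP HW1; have : H \subset H^`(1)%g.
    by rewrite -quotient_sub1 // HW1.
  case: spH => _ _ _ /abelem_abelian abW sHW; apply/eqP/derG1P.
  exact: abelianS abW.
pose q h := abelem_rV abel_quo ntQ (coset H^`(1) h).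
have qM a b : a \in H -> b \in H -> q (a * b)%g = q a + q b.
  move=> Ha Hb; rewrite /q morphM ?(subsetP nH) //.
  by rewrite abelem_rV_M ?mem_quotient.
have qX a k : a \in H -> q (a ^+ k)%g = k%:R *: q a.
  by move=> Ha; rewrite /q morphX ?(subsetP nH) // abelem_rV_X ?mem_quotient.
have qPw u : q (gen_prod u) = redv u *m \matrix_i q (x i).
  rewrite /gen_prod (group_hom_prod qM) ?mulmx_sum_row; last by move=> i; rewrite groupX.
  by apply: eq_bigr => i _; rewrite rowK qX // mxE.
have q_der h : h \in H^`(1)%g -> q h = 0.
  by move=> Wh; rewrite /q coset_id // -(abelem_rV_1 abel_quo ntQ).
set Q := \matrix_i q (x i) in qPw.
have fullQ : row_full Q.
  rewrite -sub1mx; apply/row_subP=> i.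
  have : rVabelem abel_quo ntQ (row i 1%:M) \in (H / H^`(1))%g by apply: mem_rVabelem.
  case/morphimP=> h _ Hh hE; have [u [T hT]] := gen_prodP Hh.
  apply/submxP; exists (redv u); rewrite -qPw.
  rewrite -[LHS](rVabelemK abel_quo ntQ) hE -/(q h) hT qM ?mem_gen_prod //.
    by rewrite (q_der (comm_prod T)) ?addr0 // mem_rV_der.
  by rewrite (subsetP (der_sub 1 H)) // mem_rV_der.
have dQ : (d <= \rank Q)%N.
  rewrite (eqnP fullQ) (dim_abelemE abel_quo ntQ) -(rank_abelem abel_quo) -grank_abelian ?(abelem_abelian abel_quo) //.
  by rewrite -[d in (d <= _)%N]grH -der_Phi grank_quotient_Phi.
have freeQ : row_free Q by rewrite /row_free eqn_leq rank_leq_row.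
by move=> /q_der; rewrite qPw => /eqP; rewrite mulmx_free_eq0 // => /eqP.
Qed.

Lemma two_Fp_neq0 : 2%:R != 0 :> 'F_p.
Proof.
rewrite -(dvdn_pcharf (pchar_Fp p_pr)) dvdn_prime2 //.
Qed.

Lemma skew_comm_prod_eq1 T : T^T = - T -> comm_prod T = 1%g -> T = 0.
Proof.
move=> skT; rewrite -comm_prod0 => /(@rVabelem_inj _ _ _ abelW ntW).
rewrite comm_vec0 => /comm_vec_eq0 lowT; apply/matrixP=> i j; rewrite mxE.
have Tji a b : T a b = - T b a by have /matrixP/(_ b a) := skT; rewrite !mxE.
have [ij|ji|/val_inj<-] := ltngtP i j; last 2 first.
- exact: lowT.
- apply/eqP; have /eqP := Tji i i; rewrite -subr_eq0 opprK -mulr2n -mulr_natl.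
  by rewrite mulf_eq0 (negPf two_Fp_neq0).
by rewrite Tji lowT ?oppr0.
Qed.

(** Skew matrices serve as normal forms for elements of [H']; uniqueness comes from
    [skew_comm_prod_eq1]. *)
Lemma skew_rep (T : 'M['F_p]_d) : exists2 S : 'M['F_p]_d, S^T = - S & comm_prod S = comm_prod T.
Proof.
pose L := \matrix_(i, j) if (j < i)%N then T i j else 0.
exists (L - L^T); first by rewrite linearB /= trmxK opprB.
rewrite /comm_prod; congr rV_der; apply: eq_comm_vec => k j jk.
by rewrite !mxE jk ltnNge (ltnW jk) /= subr0.
Qed.

Lemma power_matrices : exists f : 'I_d -> 'M['F_p]_d,
  (forall i, (f i)^T = - f i) /\ (forall i, x i ^+ p = comm_prod (f i))%g.
Proof.
suff /fin_all_exists[f fP] i : exists g : 'M['F_p]_d, g^T = - g /\ (x i ^+ p = comm_prod g)%g.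
  by exists f; split=> i; case: (fP i).
have [T ->] := der_comm_prod (exp_der (Hx i)); have [S skS cS] := skew_rep T.
by exists S.
Qed.

Variable f : 'I_d -> 'M['F_p]_d.
Hypotheses (fN : forall i, (f i)^T = - f i) (xf : forall i, (x i ^+ p = comm_prod (f i))%g).

Definition fsum (u : 'rV['F_p]_d) : 'M['F_p]_d := \sum_i u 0 i *: f i.

Lemma fsum_skew u : (fsum u)^T = - fsum u.
Proof.
rewrite /fsum linear_sum -sumrN; apply: eq_bigr => i _.
by rewrite linearZ /= fN scalerN.
Qed.

Lemma comm_vec_fsum u : comm_vec (fsum u) = \sum_i u 0 i *: comm_vec (f i).
Proof. by rewrite /fsum (big_morph comm_vec comm_vecD comm_vec0); apply: eq_bigr => i _; rewrite comm_vecZ. Qed.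

Lemma der_rV_comm_prod T : der_rV (comm_prod T) = comm_vec T.
Proof. exact: rVabelemK. Qed.

Lemma exp_gen_prod v : (gen_prod v ^+ p = comm_prod (fsum (redv v)))%g.
Proof.
rewrite -[LHS]rV_derK ?exp_der ?mem_gen_prod //; congr rV_der; rewrite comm_vec_fsum.
rewrite (@group_hom_prod _ H _ (fun h => der_rV (h ^+ p)%g)); last first.
- by move=> i; rewrite groupX.
- by move=> a b Ha Hb; rewrite (expMp p_pr p_neq2 spH) // der_rVM ?exp_der.
apply: eq_bigr => i _; rewrite -expgM mulnC expgM der_rVX ?exp_der //.
by rewrite xf der_rV_comm_prod mxE.
Qed.

(** The overlap of the two kinds of coordinates: a degree 1 vector divisible by [p] represents an
    element of [H']. *)
Lemma gen_prod_iota u : gen_prod (map_mx (@iota_p p) u) = comm_prod (fsum u).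
Proof.
have xE i : (x i ^+ (map_mx (@iota_p p) u 0 i)%R = (x i ^+ p) ^+ (u 0%R i))%g.
  by rewrite mxE /iota_p Zp2_natE // expg_mod ?exp_p_square // expgM.
have xW i : (x i ^+ (map_mx (@iota_p p) u 0 i)%R)%g \in H^`(1)%g.
  by rewrite xE groupX ?exp_der.
rewrite -[LHS]rV_derK ?group_prod //; congr rV_der; rewrite comm_vec_fsum.
rewrite (@group_hom_prod _ H^`(1)%G _ der_rV) //; last exact: der_rVM.
apply: eq_bigr => i _; rewrite xE der_rVX ?exp_der // xf der_rV_comm_prod.
by rewrite Fp_natK.
Qed.

(** [H^p] lies in the cyclic group generated by [comm_prod w], and some [x i ^+ p] is nontrivial
    because [f i] is a nonzero skew matrix. *)
Lemma card_power_rank1 (e : 'rV['F_p]_d) w : e != 0 -> w != 0 ->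
  (forall i, f i = e 0 i *: w) -> #|power_subgroup p H| = p.
Proof.
move=> e0 w0 fe.
have sub : power_subgroup p H \subset <[comm_prod w]>%g.
  rewrite gen_subG; apply/subsetP=> _ /imsetP[h Hh ->].
  have [v [T ->]] := gen_prodP Hh.
  have WT : comm_prod T \in H^`(1)%g := mem_rV_der _.
  rewrite (expMp p_pr p_neq2 spH) ?mem_gen_prod ?(subsetP (der_sub 1 H)) //.
  rewrite (der_exp p_pr spH WT) mulg1 exp_gen_prod.
  have -> : fsum (redv v) = (\sum_i redv v 0 i * e 0 i) *: w.
    by rewrite scaler_suml; apply: eq_bigr => i _; rewrite fe scalerA.
  by rewrite /comm_prod comm_vecZ /rV_der rVabelemZ mem_cycle.
have dv : (#|power_subgroup p H| %| p)%N.
  by rewrite (dvdn_trans (cardSg sub)) // order_dvdn (der_exp p_pr spH) // mem_rV_der.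
have /primeP[_ /(_ _ dv)/orP[|/eqP//]] := p_pr.
rewrite -trivg_card1 => /eqP P1.
have [i ei] : exists i, e 0 i != 0.
  apply/existsP; apply: contraNT e0; rewrite negb_exists => /forallP e0.
  by apply/eqP/rowP=> i; rewrite mxE; apply/eqP/negPn.
have := power_mem p (Hx i); rewrite P1 inE xf => /eqP/skew_comm_prod_eq1-/(_ (fN i))/eqP.
by rewrite fe scaler_eq0 (negPf ei) (negPf w0).
Qed.
End Coordinates.

(** * The cover *)

(* V, T and Z are the pieces of degree 1, 2 and 3 of a truncated graded algebra,
   with associativity e_lrA; e_pi is an additional bilinear cocycle. *)
Record ext_data (V T Z : zmodType) := ExtData {
  e_mu : V -> V -> T;
  e_l : T -> V -> Z;
  e_r : V -> T -> Z;
  e_pi : V -> V -> Z;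
  e_muDl : forall u v w, e_mu (u + v) w = e_mu u w + e_mu v w;
  e_muDr : forall u v w, e_mu w (u + v) = e_mu w u + e_mu w v;
  e_lDl : forall s t w, e_l (s + t) w = e_l s w + e_l t w;
  e_lDr : forall u v t, e_l t (u + v) = e_l t u + e_l t v;
  e_rDl : forall u v t, e_r (u + v) t = e_r u t + e_r v t;
  e_rDr : forall s t w, e_r w (s + t) = e_r w s + e_r w t;
  e_piDl : forall u v w, e_pi (u + v) w = e_pi u w + e_pi v w;
  e_piDr : forall u v w, e_pi w (u + v) = e_pi w u + e_pi w v;
  e_lrA : forall u v w, e_r u (e_mu v w) = e_l (e_mu u v) w }.

(** The parameter [D] does not affect the carrier; it lets each choice of data have its own group
    structure. *)
Definition ext_group (V T Z : finZmodType) (D : ext_data V T Z) : Type :=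
  (V * T * Z)%type.

Section ExtGroup.
Variables (V T Z : finZmodType) (D : ext_data V T Z).
Local Notation X := (ext_group D).
Local Notation mu := (e_mu D).

HB.instance Definition _ := Finite.on X.

Definition ext_mul (a b : X) : X :=
  (a.1.1 + b.1.1, a.1.2 + b.1.2 + mu a.1.1 b.1.1,
   a.2 + b.2 + (e_l D a.1.2 b.1.1 + e_r D a.1.1 b.1.2 + e_pi D a.1.1 b.1.1)).
Definition ext_one : X := (0, 0, 0).
Definition ext_inv (a : X) : X :=
  (- a.1.1, - a.1.2 - mu (- a.1.1) a.1.1,
   - a.2 - (e_l D (- a.1.2 - mu (- a.1.1) a.1.1) a.1.1 + e_r D (- a.1.1) a.1.2
            + e_pi D (- a.1.1) a.1.1)).

Let add0 (A B : zmodType) (g : A -> B) : (forall u v, g (u + v) = g u + g v) -> g 0 = 0.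
Proof. by move=> gD; apply: (addrI (g 0)); rewrite -gD !addr0. Qed.

Lemma ext_mulA : associative ext_mul.
Proof.
case=> [[u s] y] [[v t] z] [[w r] q]; rewrite /ext_mul /=.
congr (_, _, _); first by rewrite addrA.
  by rewrite (e_muDl D) (e_muDr D) !addrA [LHS](ACl (1*2*5*3*6*4)).
rewrite !(e_lDl, e_lDr, e_rDl, e_rDr, e_piDl, e_piDr, e_lrA) !addrA.
by rewrite [LHS](ACl (1*2*7*9*12*3*8*4*11*10*5*13*6)).
Qed.

Lemma ext_mul1g : left_id ext_one ext_mul.
Proof.
case=> [[u s] y]; rewrite /ext_mul /=.
rewrite (add0 (fun a b => e_muDl D a b u)) (add0 (fun a b => e_lDl D a b u)).
rewrite (add0 (fun a b => e_rDl D a b s)) (add0 (fun a b => e_piDl D a b u)).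
by rewrite !add0r !addr0.
Qed.

Lemma ext_mulVg : left_inverse ext_one ext_inv ext_mul.
Proof.
case=> [[u s] y]; rewrite /ext_mul /ext_inv /=.
have canc (A : zmodType) (a b : A) : - a - b + a + b = 0.
  by rewrite -addrA [a + b]addrC addrA subrK addNr.
by congr (_, _, _); rewrite ?addNr ?canc.
Qed.

HB.instance Definition _ := Finite_isGroup.Build X ext_mulA ext_mul1g ext_mulVg.

Lemma ext_mulE (a b : X) : (a * b)%g = ext_mul a b. Proof. by []. Qed.
End ExtGroup.

Section Cover.
Variables (p d : nat) (gT : finGroupType) (H : {group gT}).
Hypotheses (p_pr : prime p) (p_neq2 : (p != 2)%N) (spH : special_pgroup p H).
Variable x : 'I_d -> gT.
Hypothesis genx : <<[set x i | i in 'I_d]>>%g = H.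
Hypothesis cardW : #|H^`(1)%g| = (p ^ (d * (d - 1))./2)%N.
Hypothesis grH : 'm(H) = d.
Variable f : 'I_d -> 'M['F_p]_d.
Hypotheses (fN : forall i, (f i)^T = - f i).
Local Notation comm_prod := (comm_prod spH x).
Local Notation gen_prod := (gen_prod x).
Hypothesis xf : forall i, (x i ^+ p = comm_prod (f i))%g.

Let nz2 : 2%:R != 0 :> 'F_p := two_Fp_neq0 p_pr p_neq2.

Local Notation m := #|{: 'I_d * 'I_d * 'I_d}|.
(* Right multiplication by lam kills exactly the span of the relations. *)
Definition lam : 'M['F_p]_m := cokermx (power_rel f).

Definition comm_mx i j := lie (f i) (delta_mx 0 j) *m lam.

Lemma comm_mxC i j : comm_mx i j = - comm_mx j i.
Proof.
apply/eqP; rewrite -addr_eq0 /comm_mx -mulmxDl -sub_kermx.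
have /eqP : power_rel f *m lam == 0 by rewrite -submxE.
move=> /(congr1 (row (enum_rank (i, j)))); rewrite row_mul rowK enum_rankK /= row0.
by rewrite sub_kermx => ->.
Qed.

(** As [comm_mx] is skew, the factor 1/2 makes the antisymmetrised cocycle equal to it. The values
    are lifted to Z/p^2 so that a factor [p] in an argument sends them into the image of [iota_mx]
    instead of killing them. *)
Definition pi_mx i j : 'rV['Z_(p ^ 2)]_m :=
  map_mx (fun u : 'F_p => (u : nat)%:R) (2%:R^-1 *: comm_mx i j).

Lemma red_pi_mx i j : map_mx (@red p) (pi_mx i j) = 2%:R^-1 *: comm_mx i j.
Proof. by apply/rowP=> k; rewrite !mxE red_nat // Fp_natK. Qed.

Definition pi_form (u v : 'rV['Z_(p ^ 2)]_d) : 'rV['Z_(p ^ 2)]_m :=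
  \sum_i \sum_j (u 0 i * v 0 j) *: pi_mx i j.

Definition iota_mx k := map_mx (@iota_p p) : 'rV['F_p]_k -> 'rV['Z_(p ^ 2)]_k.

Lemma iota_mxD k : {morph @iota_mx k : u v / u + v}.
Proof. by move=> u v; apply/rowP=> i; rewrite !mxE iota_pD. Qed.

Lemma redvD : {morph @redv p d : u v / u + v}.
Proof. by move=> u v; apply/rowP=> i; rewrite !mxE redD. Qed.

(** Degree 3 also has coordinates in Z/p^2: the tensor products take values in the multiples of [p],
    while [pi_form] need not. The components must unfold later, hence [Defined]. *)
Definition cover_data : ext_data 'rV['Z_(p ^ 2)]_d 'M['F_p]_d 'rV['Z_(p ^ 2)]_m.
Proof.
apply: (@ExtData _ _ _ (fun u v => (redv u)^T *m redv v)
  (fun t v => iota_mx (tensl t (redv v) *m lam))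
  (fun v t => iota_mx (tensr (redv v) t *m lam)) pi_form).
- by move=> u v w; rewrite redvD linearD mulmxDl.
- by move=> u v w; rewrite redvD mulmxDr.
- by move=> s t w; rewrite tenslDl mulmxDl iota_mxD.
- by move=> u v t; rewrite redvD linearD mulmxDl iota_mxD.
- by move=> u v t; rewrite redvD tensrDl mulmxDl iota_mxD.
- by move=> s t w; rewrite linearD mulmxDl iota_mxD.
- move=> u v w; rewrite -big_split; apply: eq_bigr => i _.
  rewrite -big_split; apply: eq_bigr => j _; by rewrite mxE mulrDl scalerDl.
- move=> u v w; rewrite -big_split; apply: eq_bigr => i _.
  rewrite -big_split; apply: eq_bigr => j _; by rewrite mxE mulrDr scalerDl.
- by move=> u v w; rewrite tenslrA.
Defined.

Lemma iota_mx_inj k : injective (@iota_mx k).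
Proof.
move=> u v /rowP e; apply/rowP=> i; have := e i; rewrite !mxE => ei.
apply/eqP; rewrite -subr_eq0; apply/eqP/(iota_p_eq0 p_pr).
by apply: (addIr (iota_p (v 0 i))); rewrite -iota_pD // subrK add0r.
Qed.

Lemma redv0 : redv 0 = 0 :> 'rV['F_p]_d.
Proof. by apply: (addrI (redv 0)); rewrite -redvD !addr0. Qed.

Lemma redv_iota u : redv (iota_mx u) = 0 :> 'rV_d.
Proof. by apply/rowP=> i; rewrite !mxE red_iota. Qed.

Definition pi_red (u v : 'rV['F_p]_d) : 'rV['F_p]_m :=
  \sum_i \sum_j (u 0 i * v 0 j) *: (2%:R^-1 *: comm_mx i j).

Lemma iota_mx_sum k (I : finType) (F : I -> 'rV['F_p]_k) :
  iota_mx (\sum_i F i) = \sum_i iota_mx (F i).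
Proof.
by apply: (big_morph _ (@iota_mxD k)); apply: (addrI (iota_mx 0)); rewrite -iota_mxD !addr0.
Qed.

Lemma pi_form_iotal u v : pi_form (iota_mx u) v = iota_mx (pi_red u (redv v)).
Proof.
rewrite iota_mx_sum; apply: eq_bigr => i _; rewrite iota_mx_sum; apply: eq_bigr => j _.
by rewrite -red_pi_mx; apply/rowP=> k; rewrite !mxE !iota_pM.
Qed.

Lemma pi_form_iotar u v : pi_form v (iota_mx u) = iota_mx (pi_red (redv v) u).
Proof.
rewrite iota_mx_sum; apply: eq_bigr => i _; rewrite iota_mx_sum; apply: eq_bigr => j _.
by rewrite -red_pi_mx; apply/rowP=> k; rewrite !mxE [_ * iota_p _]mulrC !iota_pM // [u _ _ * _]mulrC.
Qed.

Lemma lie_fsum u v : lie (fsum f u) v = \sum_i \sum_j (u 0 i * v 0 j) *: lie (f i) (delta_mx 0 j).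
Proof.
have lieZl k t w : lie (k *: t) w = k *: lie t w :> 'rV['F_p]_m.
  by apply/rowP=> s; rewrite !mxE; ring.
have lie0 w : lie 0 w = 0 :> 'rV['F_p]_m by rewrite -(scale0r 0) lieZl scale0r.
rewrite /fsum (big_morph (fun t => lie t v) (fun s t => lieDl s t v) (lie0 v)).
apply: eq_bigr => i _; rewrite lieZl {1}[v]row_sum_delta.
have lieD w1 w2 : lie (f i) (w1 + w2) = lie (f i) w1 + lie (f i) w2.
  by have := @lie_is_linear _ _ (f i) 1 w1 w2; rewrite !scale1r.
have lie00 : lie (f i) 0 = 0 by apply: (addrI (lie (f i) 0)); rewrite -lieD !addr0.
rewrite (big_morph _ lieD lie00) scaler_sumr; apply: eq_bigr => j _.
have := @lie_is_linear _ _ (f i) (v 0 j) (delta_mx 0 j) 0.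
by rewrite !addr0 lie00 addr0 => ->; rewrite scalerA.
Qed.

Lemma pi_red_skew u v : pi_red u v - pi_red v u = lie (fsum f u) v *m lam.
Proof.
rewrite lie_fsum mulmx_suml /pi_red [X in _ - X]exchange_big -sumrB.
apply: eq_bigr => i _; rewrite mulmx_suml -sumrB; apply: eq_bigr => j _.
rewrite -scalemxAl -/(comm_mx i j) [v 0 j * _]mulrC -scalerBr; congr (_ *: _).
rewrite [comm_mx j i]comm_mxC scalerN opprK -scalerDl -mulr2n -[_ *+ 2]mulr_natl.
by rewrite divff ?scale1r.
Qed.

Local Notation X := (ext_group cover_data).

(** Such an element has degree 1 part zero modulo [p]. Its [t] contributes [[t, v]] to the
    commutator, and the cocycle contributes [[fsum f u, v]]: thus p u in degree 1 acts like
    [fsum f u] in degree 2, as the power map demands. *)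
Lemma commute_cover u t z (b : X) :
  commute ((iota_mx u, t, z) : X) b <-> lie (fsum f u + t) (redv b.1.1) *m lam = 0.
Proof.
case: b => [[v s] y]; rewrite /commute !ext_mulE /ext_mul /=.
have tr0 w : tensr 0 w = 0 :> 'rV['F_p]_m by apply/rowP=> k; rewrite !mxE mul0r.
have io0 : iota_mx (0 : 'rV['F_p]_m) = 0.
  by apply: (addrI (iota_mx 0)); rewrite -iota_mxD !addr0.
rewrite redv_iota trmx0 mul0mx mulmx0 linear0 tr0 mul0mx io0 add0r !addr0.
rewrite pi_form_iotal pi_form_iotar -!iota_mxD.
rewrite [iota_mx u + v]addrC [t + s]addrC [z + y]addrC.
rewrite lieDl mulmxDl -pi_red_skew /lie [in X in _ <-> _ + X = 0]mulmxBl.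
set A := tensl _ _ *m _; set B := tensr _ _ *m _; set C := pi_red _ _; set C' := pi_red _ _.
have e : C - C' + (A - B) = (A + C) - (B + C').
  by rewrite [in RHS]opprD [RHS]addrACA addrC.
rewrite e; split=> [e1|/eqP]; last by rewrite subr_eq0 => /eqP->.
have := congr1 snd e1; rewrite [LHS]/= [RHS]/= => /addrI/iota_mx_inj.
by rewrite -/A -/B -/C -/C' => ->; rewrite subrr.
Qed.

Definition cover_proj (a : X) : gT := (gen_prod a.1.1 * comm_prod a.1.2)%g.

Lemma cover_projM : {morph cover_proj : a b / (a * b)%g}.
Proof.
move=> a b; rewrite /cover_proj ext_mulE /ext_mul /=.
rewrite [_ + (redv a.1.1)^T *m _]addrC !comm_prodD mulgA -(gen_prodM p_pr spH genx).
rewrite -!mulgA; congr (_ * _)%g; rewrite !mulgA; congr (_ * _)%g.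
exact/commute_sym/(rV_der_commute _ _ (mem_gen_prod genx _)).
Qed.

Lemma cover_proj_mem a : cover_proj a \in H.
Proof.
by rewrite groupM ?(mem_gen_prod genx) // (subsetP (der_sub 1 H)) // mem_rV_der.
Qed.

(** The shuffle relation in degree 2, that is, 1 + v + t is group-like up to degree 2. It fixes the
    symmetric part of [t], leaving only a skew matrix free. *)
Definition cover_set := [set a : X | a.1.2 + a.1.2^T == (redv a.1.1)^T *m redv a.1.1].

Lemma group_set_cover : group_set cover_set.
Proof.
apply/group_setP; split=> [|a b].
  by rewrite inE /= trmx0 addr0 redv0 mulmx0.
rewrite !inE => /eqP ea /eqP eb; rewrite ext_mulE /ext_mul /=.
rewrite redvD !linearD /= trmx_mul trmxK !mulmxDl -ea -eb !addrA.
by rewrite [X in X == _](ACl (1*4*6*3*2*5)).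
Qed.
Canonical cover_group := Group group_set_cover.

Lemma half_cover v : 2%:R^-1 *: ((redv v)^T *m redv v) +
  (2%:R^-1 *: ((redv v)^T *m redv v))^T = (redv v)^T *m redv v :> 'M['F_p]_d.
Proof.
rewrite linearZ /= trmx_mul trmxK -scalerDl -mulr2n -[_ *+ 2]mulr_natl.
by rewrite divff ?scale1r.
Qed.

Lemma cover_proj_surj h : h \in H -> exists2 a, a \in cover_group & cover_proj a = h.
Proof.
move=> /(gen_prodP p_pr spH genx)[v [T ->]].
pose h2 := 2%:R^-1 *: ((redv v)^T *m redv v) : 'M['F_p]_d.
have [S skS cS] := skew_rep spH x (T - h2).
exists ((v, h2 + S, 0) : X).
  by rewrite inE /= linearD /= skS addrACA subrr addr0 half_cover.
by rewrite /cover_proj /= comm_prodD cS -comm_prodD addrC subrK.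
Qed.

Lemma red_lift (u : 'rV['F_p]_d) : exists v : 'rV['Z_(p ^ 2)]_d, redv v = u.
Proof.
exists (map_mx (fun u : 'F_p => (u : nat)%:R) u).
by apply/rowP=> i; rewrite !mxE red_nat // Fp_natK.
Qed.

Lemma redv_eq0 (v : 'rV['Z_(p ^ 2)]_d) : redv v = 0 -> exists u, v = iota_mx u.
Proof.
move=> /rowP v0; have /fin_all_exists[u uP] i : exists u, v 0 i = iota_p u.
  by apply: (red_eq0 p_pr); have := v0 i; rewrite !mxE.
by exists (\row_i u i); apply/rowP=> i; rewrite !mxE uP.
Qed.

Lemma cover_proj_iota u t z : cover_proj ((iota_mx u, t, z) : X) = comm_prod (fsum f u + t).
Proof. by rewrite /cover_proj /= (gen_prod_iota p_pr genx xf) -comm_prodD. Qed.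

(** By [gen_prod_der] the degree 1 part is divisible by [p], so the condition of [cover_set] makes
    [t] skew. *)
Lemma cover_kernel (a : X) : a \in cover_group -> cover_proj a \in H^`(1)%g ->
  exists u t z, a = (iota_mx u, t, z) /\ (fsum f u + t)^T = - (fsum f u + t).
Proof.
case: a => [[v t] z]; rewrite inE /cover_proj /= => /eqP tt.
rewrite groupMr ?mem_rV_der // => /(gen_prod_der p_pr spH genx grH) v0.
have [u vu] := redv_eq0 v0; exists u, t, z; rewrite vu; split=> //.
rewrite v0 mulmx0 in tt; rewrite linearD /= (fsum_skew fN) opprD; congr (_ + _).
by apply/eqP; rewrite -addr_eq0 addrC tt.
Qed.

(* If the lift of comm_prod w, w <> 0, were central, all the Lie products
   [w, v] would be combinations of the relations [f_i, e_j] + [f_j, e_i]. *)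
Lemma special_capable : #|power_subgroup p H| != p -> capable (subg_of H).
Proof.
move=> cardP; apply/capableP.
exists (subg_of cover_group), (fun a => subg H (cover_proj (sgval a))); split.
- by move=> a b; rewrite -subgM ?cover_proj_mem // -cover_projM.
- move=> h; have [a Ga ah] := cover_proj_surj (subgP h).
  by exists (subg cover_group a); rewrite subgK // ah sgvalK.
move=> a; split=> [ra|/in_centerP ca].
  have {}ra : cover_proj (sgval a) = 1%g.
    by have := congr1 sgval ra; rewrite subgK ?cover_proj_mem.
  have [|u [t [z [aE sk]]]] := cover_kernel (subgP a); first by rewrite ra group1.
  have w0 : fsum f u + t = 0.
    apply: (skew_comm_prod_eq1 p_pr p_neq2 genx cardW sk).
    by rewrite -(cover_proj_iota u t z) -aE.
  apply/in_centerP=> b; apply: val_inj => /=; rewrite aE.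
  apply/commute_cover; rewrite w0 (_ : lie 0 _ = 0) ?mul0mx //.
  by apply/rowP=> k; rewrite !mxE mul0r mulr0 subrr.
(* The projection is onto [H], so it maps central elements into ['Z(H)], which is [H']. *)
have rz : cover_proj (sgval a) \in H^`(1)%g.
  rewrite (der_center spH); apply/setIP; split; first exact: cover_proj_mem.
  apply/centP=> h Hh; have [b Gb <-] := cover_proj_surj Hh.
  rewrite /commute -!cover_projM; congr cover_proj.
  by have := congr1 sgval (ca (subg _ b)); rewrite /= subgK.
have [u [t [z [aE sk]]]] := cover_kernel (subgP a) rz.
suff w0 : fsum f u + t = 0.
  apply: val_inj; rewrite /= subgK ?cover_proj_mem // aE cover_proj_iota w0 comm_prod0 //.
apply/eqP; apply: contraNT cardP => w0.
have [l|e e0 fe] := power_rel_rank1 nz2 fN sk w0; last first.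
  by rewrite (card_power_rank1 p_pr p_neq2 genx cardW fN xf e0 w0 fe).
have [v vl] := red_lift (delta_mx 0 l).
pose b := ((v, 2%:R^-1 *: ((redv v)^T *m redv v), 0) : X).
have Gb : b \in cover_group by rewrite inE /= half_cover.
have /commute_cover : commute ((iota_mx u, t, z) : X) b.
  by have := congr1 sgval (ca (subg _ b)); rewrite /= subgK // aE.
by rewrite /= vl => /eqP; rewrite -submxE.
Qed.
End Cover.

(* Non-capable special groups of maximal rank *)
Local Close Scope ring_scope.

Theorem theorem2p13 (p d : nat) (gT : finGroupType) (H : {group gT})
    (p_prime : prime p) (p_neq2 : p != 2) (d_ge3 : 3 <= d)
    (H_gens : 'm(H) = d) (H_special : special_pgroup p H)
    (H_rank : #|H^`(1)| = (p ^ (d * (d - 1))./2)%N) :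
  ~ capable (subg_of H) <-> power_subgroup p H \isog Zp p.
Proof.
have cardZ : #|Zp p| = p by rewrite card_Zp ?prime_gt0.
split=> [ncH|/card_isog cP]; last first.
  by apply: (card_power_not_capable p_prime p_neq2 H_special); rewrite cP.
have [B genB cardB] := grank_witness H; rewrite H_gens in cardB.
pose x i : gT := enum_val (cast_ord (esym cardB) i).
have genx : <<[set x i | i in 'I_d]>>%g = H.
  rewrite -genB; congr <<_>>%g; apply/setP=> b; apply/imsetP/idP=> [[i _ ->]|Bb].
    exact: enum_valP.
  by exists (cast_ord cardB (enum_rank_in Bb b)); rewrite // /x cast_ordK enum_rankK_in.
have [f [fN xf]] := power_matrices p_prime H_special genx.
have cardP : #|power_subgroup p H| = p.
  apply/eqP; apply: contra_notT ncH => cardP.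
  exact: (special_capable p_prime p_neq2 genx H_rank H_gens fN xf).
rewrite isog_cyclic_card; last by rewrite prime_cyclic ?cardP.
by rewrite prime_cyclic cardZ // cardP eqxx.
Qed.
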